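(* Let $m,n\ge 1$, let $B$ be the $m\times n$ rectangular chessboard, and let $G$ be a crosspatch knight pseudotour on $B$. Then $G$ consists of an even number of cycles (i.e. $G$ has an even number of connected components).
   Context: Represent the square in column $i$ and row $j$ of $B$ ($1\le i\le m$, $1\le j\le n$) by the point $(i,j)$ of the plane; a knight move between two squares is represented by the segment joining the corresponding points. A knight pseudotour on $B$ is a graph $G$ whose vertex set is the set of all squares of $B$, whose edges are (undirected) knight moves, and in which every vertex has degree exactly $2$; it is thus a disjoint union of cycles. Two knight moves form a cross if the midpoints of their segments coincide. $G$ is crosspatch if every edge of $G$ forms a cross with some other edge of $G$. *)

(* Defs.v *)
(* Mathematical Components. *)
From mathcomp Require Import all_boot all_order all_algebra.
Set Implicit Arguments.
Unset Strict Implicit.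
Unset Printing Implicit Defensive.
Import Order.TTheory GRing.Theory Num.Theory.

Local Open Scope ring_scope.

(* Columns and rows are indexed from 0 in 'I_m and 'I_n. *)
Definition square (m n : nat) : finType := ('I_m * 'I_n)%type.

(* The 0-based indices are shifted, so the board is {1..m} x {1..n}. *)
Definition point m n (s : square m n) : rat * rat :=
  (s.1.+1%:R, s.2.+1%:R).

Definition knight_move m n (s t : square m n) : bool :=
  let dx := `|(point s).1 - (point t).1| in
  let dy := `|(point s).2 - (point t).2| in
  ((dx == 1) && (dy == 2)) || ((dx == 2) && (dy == 1)).

Definition midpoint m n (s t : square m n) : rat * rat :=
  (((point s).1 + (point t).1) / 2, ((point s).2 + (point t).2) / 2).

(* A graph on the squares is given by its adjacency relation.  Loops are
   excluded because a square is not a knight move away from itself. *)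
Definition knight_pseudotour m n (G : rel (square m n)) : Prop :=
  [/\ symmetric G,
      forall s t, G s t -> knight_move s t &
      forall s, #|[set t | G s t]| = 2%N].

(* An edge is the unordered pair of its endpoints, so the second edge has to
   differ from the first one as a set, not merely as an ordered pair. *)
Definition crosspatch m n (G : rel (square m n)) : Prop :=
  forall s t, G s t ->
    exists u v, [/\ G u v, [set u; v] != [set s; t] &
                    midpoint u v = midpoint s t].

(* For a symmetric G, the equivalence classes of connect G are the connected
   components; n_comp counts their canonical representatives. *)
Definition num_components m n (G : rel (square m n)) : nat :=
  n_comp G predT.

(* Main.v *)
Require Import Defs.
From mathcomp Require Import all_boot all_order all_algebra.
From HB Require Import structures.
From mathcomp Require Import perm zify.
Set Implicit Arguments.
Unset Strict Implicit.
Unset Printing Implicit Defensive.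
Import GRing.Theory Num.Theory.

(** Colour a lattice point [p] by the parity of the number of crosses centred
    in the row of [p] and to the left of [p].  Since all degrees are even, this
    parity is also that of the number of crosses centred in the column of [p]
    and below [p], so there is a set [F] of points such that the midpoint of two
    neighbouring points is the centre of a cross iff exactly one of them lies
    in [F].  If [p], [q] are consecutive among the eight king neighbours of
    [v], the knight move from [v] to [p + q - v] thus belongs to [G] iff
    exactly one of [p], [q] lies in [F]; that [v] has degree 2 says that its
    ring of king neighbours changes colour exactly twice.

    On pairs (vertex, king direction) let [turn] rotate every direction by one
    step, let [spin] rotate the eight vertices around each point of [F] by three
    steps, and let [trace] be [spin] followed by [turn].  Every orbit of [trace]
    is either of length 2, along a knight move both of whose sides lie in [F]
    (there are evenly many such moves, two for each pair of neighbours in [F]),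
    or winds around a vertex off the board, or follows one cycle of [G].
    Comparing signs, the number of cycles of [G] has the parity of
    [#|board| + #|F|].  Counting degrees column by column modulo 2 shows that
    both the area of the board and [#|F|] are even. *)

(** * The orbits of a set of lattice points *)

Lemma iter_modn_order (T : finType) (f : T -> T) (x : T) (k : nat) :
  injective f -> iter k f x = iter (k %% order f x) f x.
Proof.
move=> f_inj; rewrite {1}(divn_eq k (order f x)) addnC iterD.
congr (iter _ _ _).
by elim: (k %/ _)%N => //= q IHq; rewrite mulSn iterD IHq iter_order.
Qed.

(** The order divides [2 ^ k.+1], hence is a power of 2; any smaller power would divide [2 ^ k]. *)
Lemma order_pow2 (T : finType) (f : T -> T) (x : T) (k : nat) :
    injective f -> iter (2 ^ k.+1) f x = x -> iter (2 ^ k) f x != x ->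
  order f x = (2 ^ k.+1)%N.
Proof.
move=> f_inj fx nfx.
have : (order f x %| 2 ^ k.+1)%N.
  apply/eqP; rewrite -(findex_iter (ltn_pmod _ (order_gt0 f x))).
  by rewrite -iter_modn_order // fx findex0.
case/(dvdn_pfactor _ _ (isT : prime 2)) => j le_j ord_x.
rewrite ord_x; congr (_ ^ _)%N; apply/eqP; rewrite eqn_leq le_j ltnNge.
apply: contra nfx => le_jk; apply/eqP.
rewrite (iter_modn_order _ _ f_inj) ord_x.
by rewrite (_ : _ %% _ = 0)%N //; apply/eqP; rewrite -/(dvdn _ _) dvdn_exp2l.
Qed.

(** The sign is defined through the number of [porbit] classes, and each class contains exactly one
    of the roots counted by [fcard]. *)
Lemma odd_perm_fcard (T : finType) (s : {perm T}) :
  odd_perm s = odd #|T| (+) odd (fcard s predT).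
Proof.
rewrite /odd_perm; congr (_ (+) odd _).
have conn x y : (x \in porbit s y) = fconnect s y x.
  apply/porbitP/idP => [[i ->]|]; first by rewrite permX fconnect_iter.
  by move=> /iter_findex <-; exists (findex s y x); rewrite permX.
have sym := fconnect_sym (@perm_inj _ s).
rewrite /n_comp_mem -(@card_in_imset _ _ (porbit s)); last first.
  move=> x y /andP[/eqP rx _] /andP[/eqP ry _] /eqP.
  by rewrite eq_porbit_mem conn => /(fingraph.rootP sym); rewrite rx ry.
apply: eq_card => A; apply/imsetP/imsetP => -[x _ ->]; last by exists x.
exists (froot s x); first by rewrite inE /= roots_root.
by apply/eqP; rewrite eq_porbit_mem conn sym connect_root.
Qed.

Lemma odd_perm_of_inj (T : finType) (f : T -> T) (f_inj : injective f) :
  odd_perm (perm f_inj) = odd #|T| (+) odd (fcard f predT).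
Proof. by rewrite odd_perm_fcard (eq_fcard (permE f_inj)). Qed.

Lemma n_compU (T : finType) (e : rel T) (a b : {pred T}) :
  [disjoint a & b] -> n_comp e [predU a & b] = (n_comp e a + n_comp e b)%N.
Proof.
move=> dis; rewrite /n_comp_mem -[in LHS](cardID a).
congr (_ + _)%N; apply: eq_card => x; rewrite !inE.
  by case: (x \in a); rewrite ?orbT ?andbF ?andbT.
by case xa: (x \in a); rewrite ?(disjointFr dis xa) ?andbF.
Qed.

(** * King steps and the permutations [turn], [spin] and [trace] *)

Section King.

Local Open Scope ring_scope.

Variables (V : finZmodType) (e1 e2 : V) (F : {pred V}).

(** The steps are listed counterclockwise, so that arithmetic in ['Z_8] is rotation and adding 4
    reverses a step. *)
Definition king (i : 'Z_8) : V :=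
  nth 0 [:: e1; e1 + e2; e2; e2 - e1; - e1; - (e1 + e2); - e2; e1 - e2] i.
Local Notation d := king.

Lemma king_opp (i : 'Z_8) : d (i + 4%:R) = - d i.
Proof.
rewrite /king; case: i => [[|[|[|[|[|[|[|[|//]]]]]]]] lti] /=;
  by rewrite ?opprK // opprB.
Qed.

Lemma king_opp_pred (i : 'Z_8) : d (i + 4%:R - 1) = - d (i - 1).
Proof. by rewrite addrAC king_opp. Qed.

Local Definition shift_card (u : V) := #|[pred c | F c && F (c + u)]|.

Lemma shift_cardN (u : V) : shift_card (- u) = shift_card u.
Proof.
rewrite /shift_card -[in RHS](card_image (addIr u)); apply: eq_card => c.
rewrite inE; apply/idP/imageP => [/andP[Fc Fcu]|[b]].
  by exists (c - u); rewrite ?inE subrK ?Fc ?Fcu.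
by rewrite inE => /andP[Fb Fbu] ->; rewrite addrK Fb Fbu.
Qed.

(** These are the darts whose knight move, to [x.1 + d x.2 + d (x.2 - 1)], has both sides in [F]. *)
Definition inner : pred (V * 'Z_8) :=
  [pred x | F (x.1 + d x.2) && F (x.1 + d (x.2 - 1))].

(** Substitute [c = v + d i]. The difference [d (i - 1) - d i] is, up to sign, [e1] for four
    directions and [e2] for the other four. *)
Lemma dvdn4_card_inner : (4 %| #|inner|)%N.
Proof.
have -> : #|inner| = (\sum_(i : 'Z_8) shift_card (d (i - 1)%R - d i)%R)%N.
  under eq_bigr do rewrite /shift_card -sum1_card.
  rewrite pair_big_dep (reindex (fun x : V * 'Z_8 => (x.2, x.1 + d x.2))) /=.
    rewrite -sum1_card; apply: eq_bigl => x; rewrite !inE.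
    by rewrite [d (_ - 1) - _]addrC addrA addrK.
  exists (fun x => (x.2 - d x.1, x.1)) => [[v i]|[i v]] _ /=.
    by rewrite addrK.
  by rewrite subrK.
have shiftE (i : 'Z_8) : shift_card (d (i - 1) - d i) =
    nth 0%N [:: shift_card e2; shift_card e2; shift_card e1; shift_card e1;
                shift_card e2; shift_card e2; shift_card e1; shift_card e1] i.
  rewrite /king; case: i => [[|[|[|[|[|[|[|[|//]]]]]]]] lti] /=.
  - by rewrite addrAC subrr sub0r shift_cardN.
  - by rewrite opprD addrA subrr sub0r shift_cardN.
  - by rewrite addrK.
  - by rewrite subKr.
  - by rewrite opprK subrK.
  - by rewrite opprK addKr.
  - by rewrite opprK opprD subrK shift_cardN.
  - by rewrite opprB addKr shift_cardN.
under eq_bigr do rewrite shiftE.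
by rewrite !big_ord_recl big_ord0 /=; lia.
Qed.

Local Notation dart := (V * 'Z_8)%type.

Definition turn (x : dart) : dart := (x.1, x.2 + 1).

Definition spin (x : dart) : dart :=
  if F (x.1 + d x.2) then (x.1 + d x.2 - d (x.2 + 3%:R), x.2 + 3%:R) else x.

(** Beside a cell of [F] the dart runs along the knight move and ends up reversed; otherwise it
    turns in place. *)
Definition trace (x : dart) : dart :=
  if F (x.1 + d x.2) then (x.1 + d x.2 + d (x.2 - 1), x.2 + 4%:R)
  else (x.1, x.2 + 1).

Lemma turn_inj : injective turn.
Proof. by move=> [v i] [w j] /pair_equal_spec[/= -> /addIr ->]. Qed.

Lemma spin_cell (x : dart) : (spin x).1 + d (spin x).2 = x.1 + d x.2.
Proof. by rewrite /spin; case: ifP => //= _; rewrite subrK. Qed.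

(** The cell pointed at is invariant and decides the branch, so the dart can be recovered. *)
Lemma spin_inj : injective spin.
Proof.
move=> x y eq_xy; have := spin_cell x; rewrite eq_xy spin_cell => eq_c.
move: eq_xy; rewrite /spin eq_c.
case: ifP => // _ /pair_equal_spec[_ /addIr eq2].
by case: x y eq2 eq_c => [v i] [w j] /= -> /addIr ->.
Qed.

(** Three steps around the cell lead to the end of the knight move, because
    [- d (i + 3) = d (i - 1)]; the turn then makes [i + 3] into [i + 4]. *)
Lemma trace_comp (x : dart) : trace x = turn (spin x).
Proof.
rewrite /trace /turn /spin; case: ifP => //= _; congr (_, _).
  have -> : x.2 + 3%:R = x.2 - 1 + 4%:R.
    by rewrite -addrA; congr (_ + _); apply/eqP.
  by rewrite king_opp opprK.
by rewrite -addrA; congr (_ + _); apply/eqP.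
Qed.

Lemma trace_inj : injective trace.
Proof. by move=> x y; rewrite !trace_comp => /turn_inj /spin_inj. Qed.

Lemma fcard_full (f : dart -> dart) (a : {pred dart}) (k : nat) :
    injective f -> fclosed f a ->
    {in a, forall x, iter (2 ^ k.+1) f x = x /\ iter (2 ^ k) f x != x} ->
  (fcard f a * 2 ^ k.+1)%N = #|a|.
Proof.
move=> f_inj cl_a ord_a; apply: fcard_order_set => //; apply/subsetP => x.
by move=> /ord_a[fx nfx]; rewrite inE (order_pow2 f_inj fx nfx).
Qed.

Lemma fcard_turn : fcard turn predT = #|V|.
Proof.
have := @fcard_full turn predT 2 turn_inj.
rewrite card_prod card_ord => /(_ _ _)/eqP; rewrite eqn_pmul2r // => fcE.
apply/eqP/fcE => //; move=> [v i] _; split.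
  by congr (_, _); rewrite /= -!addrA -[RHS]addr0; congr (_ + _); apply/eqP.
rewrite xpair_eqE eqxx /= -!addrA -[X in _ == X]addr0.
by rewrite (inj_eq (addrI _)).
Qed.

Lemma card_cell_darts : #|[pred x : dart | F (x.1 + d x.2)]| = (#|F| * 8)%N.
Proof.
have inj : injective (fun x : dart => (x.1 - d x.2, x.2)).
  move=> [v i] [w j] /pair_equal_spec[/= eq1 eqi].
  by rewrite eqi in eq1 *; rewrite (addIr _ eq1).
transitivity #|predX F (mem 'Z_8)|; last by rewrite cardX card_ord.
rewrite -[in RHS](card_image inj).
apply: eq_card => -[v i]; rewrite inE /=; apply/idP/imageP => [Fv|].
  by exists (v + d i, i); rewrite ?inE /= ?andbT // addrK.
case=> [[w j]]; rewrite !inE /= andbT => Fw /pair_equal_spec[-> ->].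
by rewrite subrK.
Qed.

(** As 3 is invertible modulo 8, each cell of [F] carries one orbit of length 8. All other darts are
    fixed, and their number is a multiple of 8. *)
Lemma odd_fcard_spin : odd (fcard spin predT) = odd #|F|.
Proof.
pose a := [pred x : dart | F (x.1 + d x.2)].
have cl_a : fclosed spin a by move=> x _ /eqP <-; rewrite !inE spin_cell.
have fa : fcard spin a = #|F|.
  have := @fcard_full spin a 2 spin_inj cl_a.
  rewrite card_cell_darts => /(_ _)/eqP; rewrite eqn_pmul2r // => fcE.
  apply/eqP/fcE => -[v i] Fvi; rewrite inE /= in Fvi.
  have it k : (iter k spin (v, i)).2 = i + 3%:R *+ k /\
              (iter k spin (v, i)).1 = v + d i - d (i + 3%:R *+ k).
    elim: k => [|k [IH2 IH1]] /=; first by rewrite mulr0n addr0 addrK.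
    by rewrite /spin IH1 IH2 subrK Fvi /= [_ *+ k.+1]mulrSr [i + (_ + _)]addrA.
  split.
    rewrite [iter _ _ _]surjective_pairing; have [-> ->] := it (2 ^ 3)%N.
    by rewrite (_ : _ *+ (2 ^ 3) = 0) ?addr0 ?addrK //; apply/eqP.
  rewrite [iter _ _ _]surjective_pairing; have [-> ->] := it (2 ^ 2)%N.
  by rewrite xpair_eqE -[X in _ && (_ == X)]addr0 (inj_eq (addrI _)) andbF.
rewrite (n_compC a) oddD fa addbC.
have := @fcard_order_set _ spin spin_inj 1 [predC a].
rewrite muln1 => ->; last by apply: predC_closed.
  have := cardC a; rewrite card_cell_darts card_prod card_ord.
  by move/(congr1 odd); rewrite oddD !oddM !andbF => /= ->.
apply/subsetP=> x; rewrite !inE => nFx; apply/eqP.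
rewrite (order_cycle (p := [:: x])) ?inE //= /spin; move/negbTE: nFx => ->.
by rewrite eqxx.
Qed.

(** * The orbits of [trace] for a graph that follows the boundary of [F] *)

Variables (T : finType) (G : rel T) (iota : T -> V).
Hypothesis iota_inj : injective iota.
Hypothesis offF : forall v i, v \notin codom iota -> ~~ F (v + d i).
Hypothesis G_sym : symmetric G.
Hypothesis GP : forall s t, G s t =
  [exists i, (F (iota s + d i) != F (iota s + d (i - 1))) &&
             (iota t == iota s + d i + d (i - 1))].

(** A rise is an entry into [F] when going around the ring. Two colour changes mean one entry and
    one exit, whence the unique rise assumed below. *)
Definition rise (s : T) (i : 'Z_8) :=
  F (iota s + d i) && ~~ F (iota s + d (i - 1)).

Hypothesis rise_ex : forall s, exists i, rise s i.
Hypothesis rise_uniq : forall s i j, rise s i -> rise s j -> i = j.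

Definition outer : pred dart := [pred x | x.1 \notin codom iota].

Definition border : pred dart := [predC [predU outer & inner]].

(** Seen from its other end, the knight move has the same two side cells, exchanged. *)
Lemma trace_cell (x : dart) : F (x.1 + d x.2) ->
  (trace x).1 + d (trace x).2 = x.1 + d (x.2 - 1).
Proof. by rewrite /trace => -> /=; rewrite king_opp addrAC addrK. Qed.

Lemma trace_cell' (x : dart) : F (x.1 + d x.2) ->
  (trace x).1 + d ((trace x).2 - 1) = x.1 + d x.2.
Proof. by rewrite /trace => -> /=; rewrite king_opp_pred addrK. Qed.

Lemma inner_closed : fclosed trace inner.
Proof.
move=> x y /eqP <-{y}; rewrite !inE; case Fx: (F (x.1 + d x.2)).
  by rewrite trace_cell // trace_cell' // Fx andbT.
by rewrite /trace Fx /= addrK Fx andbF.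
Qed.

(** Off the board [trace] only turns. A knight move made by [trace] ends next to the same cell of
    [F], hence on the board. *)
Lemma outer_closed : fclosed trace outer.
Proof.
move=> x y /eqP <-{y}; rewrite !inE; case Fx: (F (x.1 + d x.2)); last first.
  by rewrite /trace Fx.
transitivity false.
  by apply: contraTF Fx; apply: offF.
apply/esym/negbTE/negP => out; move: (Fx).
by rewrite -(trace_cell' Fx) (negbTE (offF _ out)).
Qed.

Lemma border_closed : fclosed trace border.
Proof.
apply: predC_closed => x y xy.
by rewrite inE [RHS]inE (outer_closed xy) (inner_closed xy).
Qed.

(** With both sides in [F], [trace] runs back and forth along one knight move. *)
Lemma fcard_inner : (fcard trace inner * 2)%N = #|inner|.
Proof.
apply: (@fcard_full trace inner 0 trace_inj inner_closed) => -[v i].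
rewrite inE /= => /andP[Fi Fi']; split.
  rewrite [X in trace X]/trace /= Fi /trace /= king_opp king_opp_pred.
  rewrite [v + _ + _]addrAC addrK Fi' addrK -addrA.
  by congr (_, _); rewrite -[RHS]addr0; congr (_ + _); apply/eqP.
rewrite /trace /= Fi xpair_eqE -[X in _ && (_ == X)]addr0.
by rewrite (inj_eq (addrI _)) andbF.
Qed.

Lemma fcard_outer : (fcard trace outer + #|T|)%N = #|V|.
Proof.
have := @fcard_full trace outer 2 trace_inj outer_closed.
have -> : #|outer| = (#|[predC codom iota]| * 8)%N.
  transitivity #|predX [predC codom iota] (mem 'Z_8)|.
    by apply: eq_card => x; rewrite !inE andbT.
  by rewrite cardX card_ord.
move=> fcE; have/eqP := cardC (mem (codom iota)).
rewrite card_codom // addnC => /eqP <-.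
congr (_ + _)%N; apply/eqP; rewrite -(eqn_pmul2r (isT : 0 < 8)%N).
apply/eqP/fcE => {fcE} -[v i] out; rewrite inE /= in out.
have it k : iter k trace (v, i) = (v, i + 1 *+ k).
  elim: k => [|k /= ->] /=; first by rewrite mulr0n addr0.
  by rewrite /trace /= (negbTE (offF _ out)) [_ *+ k.+1]mulrSr addrA.
rewrite !it; split.
  by congr (_, _); rewrite -[RHS]addr0; congr (_ + _); apply/eqP.
by rewrite xpair_eqE -[X in _ && (_ == X)]addr0 (inj_eq (addrI _)) andbF.
Qed.

(** This dart represents [s] among the border darts; the default 0 never occurs, by [rise_ex]. *)
Definition dart_of (s : T) : dart :=
  (iota s, odflt 0 [pick i | rise s i]).

Lemma rise_dart_of (s : T) : rise s (dart_of s).2.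
Proof.
rewrite /dart_of; case: pickP => //= none.
by have [i] := rise_ex s; rewrite none.
Qed.

Lemma rise_eq (s : T) (i : 'Z_8) : rise s i -> (iota s, i) = dart_of s.
Proof. by move=> /rise_uniq/(_ (rise_dart_of s)) ->. Qed.

(** [trace] turns until it meets the first cell of [F]; the preceding cell is not in [F], so this is
    the unique rise. *)
Lemma connect_dart_of (s : T) (i : 'Z_8) :
  ~~ F (iota s + d i) -> fconnect trace (iota s, i) (dart_of s).
Proof.
move=> nFi; pose P k := F (iota s + d (i + k%:R)).
have exP : exists k, P k.
  have /andP[Fr _] := rise_dart_of s.
  by exists ((dart_of s).2 - i)%R; rewrite /P natr_Zp [i + _]addrC subrK.
case: (ex_minnP exP) => -[|k] Pk min_k.
  by rewrite /P addr0 (negbTE nFi) in Pk.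
have zero j : (j <= k)%N -> F (iota s + d (i + j%:R)) = false.
  by move=> le_jk; apply/negP => /min_k; rewrite ltnNge le_jk.
have it j : (j <= k.+1)%N -> iter j trace (iota s, i) = (iota s, i + j%:R).
  elim: j => [|j IHj] le_jk /=; first by rewrite addr0.
  by rewrite IHj ?(ltnW le_jk) // /trace /= zero // -natr1 addrA.
rewrite -(@rise_eq s (i + k.+1%:R)) -?it ?fconnect_iter //.
by rewrite /P in Pk; rewrite /rise Pk -natr1 addrA addrK zero.
Qed.

Lemma border_iota (s : T) (i : 'Z_8) :
  ((iota s, i) \in border) = ~~ (F (iota s + d i) && F (iota s + d (i - 1))).
Proof. by rewrite !inE /= codom_f. Qed.

Lemma trace_border (s : T) (i : 'Z_8) : (iota s, i) \in border ->
  exists t j, trace (iota s, i) = (iota t, j) /\ connect G s t.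
Proof.
rewrite border_iota => nin.
case Fi: (F (iota s + d i)); last first.
  by exists s, (i + 1); rewrite /trace /= Fi connect0.
(* The vertex reached is next to a cell of [F], so [offF] puts it on the board. *)
have [/codomP[t wt]|/(@offF _ ((trace (iota s, i)).2 - 1))] :=
  boolP ((trace (iota s, i)).1 \in codom iota);
  last by rewrite trace_cell' //= Fi.
exists t, (i + 4%:R); rewrite -wt /trace /= Fi; split=> //.
apply: connect1; rewrite GP; apply/existsP; exists i; rewrite Fi.
rewrite -wt /trace /= Fi /= eqxx andbT.
by move: nin; rewrite Fi /= => /negbTE ->.
Qed.

(** Exactly one side of the edge is in [F]. If it is the side at [i], [trace] runs from [s] to [t]
    and then turns to the rise there. Otherwise the edge is a rise at [t] and is run backwards;
    connection is symmetric as [trace] is injective. *)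
Lemma connect_G_trace (s t : T) :
  G s t -> fconnect trace (dart_of s) (dart_of t).
Proof.
have step (u w : T) (i : 'Z_8) : rise u i ->
    iota w = iota u + d i + d (i - 1) -> fconnect trace (dart_of u) (dart_of w).
  move=> ri wE; have /andP[Fi nFi] := ri; rewrite -(rise_eq ri).
  have tr : trace (iota u, i) = (iota w, i + 4%:R) by rewrite /trace /= Fi wE.
  apply: connect_trans (fconnect1 _ _) _; rewrite tr; apply: connect_dart_of.
  by rewrite king_opp wE addrAC addrK.
rewrite GP => /existsP[i /andP[neq /eqP tE]].
case Fi: (F (iota s + d i)) in neq; first by apply: step tE; rewrite /rise Fi.
rewrite fconnect_sym; last exact: trace_inj.
apply: (step _ _ (i + 4%:R)).
  rewrite /rise king_opp king_opp_pred tE [_ + _ + d (i - 1)]addrAC addrK.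
  rewrite addrAC addrK Fi.
  by move: neq; case: (F _).
by rewrite king_opp king_opp_pred tE [_ + _ + d (i - 1)]addrAC !addrK.
Qed.

(** [dart_of] is an adjunction: every border dart reaches some [dart_of s], and two such darts share
    an orbit iff their vertices are connected in [G]. *)
Lemma fcard_border : fcard trace border = n_comp G predT.
Proof.
rewrite (adjunction_n_comp dart_of (e' := G) _ _ border_closed).
- apply: eq_n_comp_r => s; rewrite [LHS]border_iota.
  by have /andP[-> nF] := rise_dart_of s.
- exact/fconnect_sym/trace_inj.
- exact: sym_connect_sym.
split=> [[v i] bvi|s t _].
  have : v \in codom iota by move: bvi; rewrite inE /= negb_or negbK => /andP[].
  move=> /codomP/sig_eqW[s vE]; exists s; rewrite vE in bvi *.
  (* A border dart pointing into [F] cannot have its other side in [F], so it is a rise. *)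
  have [Fi|] := boolP (F (iota s + d i)); last exact: connect_dart_of.
  rewrite (@rise_eq s i) ?connect0 // /rise Fi.
  by move: bvi; rewrite border_iota Fi.
apply/idP/idP => [/connectP[p]|/iter_findex].
  elim: p s => [|u p IHp] s /=; first by move=> _ ->; apply: connect0.
  move=> /andP[su up] tE.
  exact: connect_trans (connect_G_trace su) (IHp _ up tE).
have reach k : exists u j, [/\ iter k trace (dart_of s) = (iota u, j),
                               (iota u, j) \in border & connect G s u].
  elim: k => [|k [u [j [/= -> bu su]]]].
    exists s, (dart_of s).2; split; rewrite ?connect0 // border_iota.
    by have /andP[-> nF] := rise_dart_of s.
  have [w [l [tr uw]]] := trace_border bu; exists w, l.
  split=> //; last exact: connect_trans uw.
  have := fclosed1 border_closed (iota u, j); by rewrite tr => <-.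
have [u [j [-> _ su]]] := reach (findex trace (dart_of s) (dart_of t)).
by move=> /pair_equal_spec[/iota_inj <-].
Qed.

(** The number of darts is a multiple of 8, so each sign is the parity of the number of orbits. Then
    sum over outer, inner and border orbits; [#|V|] cancels up to [#|T|]. *)
Theorem odd_n_comp : odd (n_comp G predT) = odd #|T| (+) odd #|F|.
Proof.
have := odd_permM (perm spin_inj) (perm turn_inj).
have -> : (perm spin_inj * perm turn_inj)%g = perm trace_inj.
  by apply/permP => x; rewrite permM !permE trace_comp.
have fcE (f : dart -> dart) (f_inj : injective f) :
    odd_perm (perm f_inj) = odd (fcard f predT).
  by rewrite odd_perm_of_inj card_prod card_ord oddM andbF addFb.
rewrite (fcE _ trace_inj) (fcE _ spin_inj) (fcE _ turn_inj).
rewrite [X in _ = X (+) _]odd_fcard_spin [X in _ = _ (+) odd X]fcard_turn.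
rewrite [X in odd X = _](n_compC border) fcard_border.
have -> : fcard trace [predC border] =
    (fcard trace outer + fcard trace inner)%N.
  rewrite -n_compU; first by apply: eq_n_comp_r => x; rewrite !inE negbK.
  rewrite disjoint_subset; apply/subsetP => x; rewrite !inE => out.
  by rewrite (negbTE (offF _ out)).
have even_inner : ~~ odd (fcard trace inner).
  by have := dvdn4_card_inner; rewrite -fcard_inner; lia.
rewrite !oddD (negbTE even_inner) addbF -fcard_outer oddD.
by case: (odd (n_comp _ _)); case: (odd (fcard _ _));
  case: (odd #|T|); case: (odd #|F|).
Qed.


End King.

(** * The colouring defined by the crosses *)

Section Height.

Variables (m n : nat) (cr hr : nat -> nat -> bool).
Hypothesis cr_supp : forall x y, cr x y -> (2 <= x <= m) && (3 <= y <= n).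
Hypothesis hr_supp : forall x y, hr x y -> (3 <= x <= m) && (2 <= y <= n).

(** This is the degree at the point [(x.+1, y.+1)], an offset that avoids predecessors. [cr x y]
    stands for a cross centred between [(x, y)] and [(x.+1, y)], and [hr x y] for one between
    [(x, y)] and [(x, y.+1)]. *)
Definition degree (x y : nat) : nat :=
  cr x y + cr x.+1 y + cr x y.+2 + cr x.+1 y.+2 +
  (hr x y + hr x y.+1 + hr x.+2 y + hr x.+2 y.+1).

Hypothesis degree2 : forall x y,
  (1 <= x <= m) && (1 <= y <= n) -> degree x y = 2.

Lemma cr0 (x y : nat) : ~~ ((2 <= x <= m) && (3 <= y <= n)) -> cr x y = false.
Proof. by apply: contraNF => /cr_supp. Qed.

Lemma hr0 (x y : nat) : ~~ ((3 <= x <= m) && (2 <= y <= n)) -> hr x y = false.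
Proof. by apply: contraNF => /hr_supp. Qed.

Lemma degree_even (x y : nat) : ~~ odd (degree x y).
Proof.
have [/degree2 -> //|off] := boolP ((1 <= x <= m) && (1 <= y <= n)).
by rewrite /degree !cr0 ?hr0 //; move: off; lia.
Qed.

Definition height (x y : nat) : bool := odd (\sum_(i < x) cr i y).

Definition hheight (x y : nat) : bool := odd (\sum_(j < y) hr x j).

Lemma height_cr (x y : nat) : height x.+1 y = height x y (+) cr x y.
Proof. by rewrite /height big_ord_recr oddD oddb. Qed.

Lemma hheight_hr (x y : nat) : hheight x y.+1 = hheight x y (+) hr x y.
Proof. by rewrite /hheight big_ord_recr oddD oddb. Qed.

(** The difference [h] of the two parities vanishes near the axes and satisfies a recurrence in
    steps of 2, given by the even degrees. *)
Lemma heightE (x y : nat) : height x y = hheight x y.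
Proof.
pose h x y := height x y (+) hheight x y.
(* The terms of [degree u v] pair up into differences of [height] along two rows and of [hheight]
   along two columns. *)
have step u v : h u.+2 v.+2 = h u v.+2 (+) h u.+2 v (+) h u v.
  have := degree_even u v; rewrite /degree /h /height /hheight !big_ord_recr /=.
  by rewrite -!oddD; lia.
have zero u v : (u < 2) || (v < 2) -> h u v = false.
  move=> small; rewrite /h /height /hheight !big1 // => i _;
    have lti := ltn_ord i; by rewrite ?cr0 ?hr0 //; move: small lti; lia.
have h0 : forall v u, h u v = false.
  elim/ltn_ind => -[|[|v]] IHv; [by move=> u; rewrite zero ?orbT..|].
  elim/ltn_ind => -[|[|u]] IHu; [by rewrite zero..|].
  by rewrite step IHu ?IHv //; lia.
by move/negbT: (h0 y x); rewrite /h; case: (height x y); case: hheight.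
Qed.

Lemma height_hr (x y : nat) : height x y.+1 = height x y (+) hr x y.
Proof. by rewrite !heightE hheight_hr. Qed.

(** The column formula bounds [x], the row formula bounds [y]. *)
Lemma height_supp (x y : nat) : height x y -> (3 <= x <= m) && (3 <= y <= n).
Proof.
move=> hxy; apply/andP; split; apply: contraLR hxy => out.
  by rewrite heightE /hheight big1 // => j _; rewrite hr0 //; lia.
by rewrite /height big1 // => j _; rewrite cr0 //; lia.
Qed.

Lemma height0 (x y : nat) :
  ~~ ((3 <= x <= m) && (3 <= y <= n)) -> height x y = false.
Proof. by apply: contraNF => /height_supp. Qed.

(** * Parity counts by columns *)

Local Notation L := n.+4.

Definition ncr (x : nat) : nat := \sum_(y < L) cr x y.
Definition nhr (x : nat) : nat := \sum_(y < L) hr x y.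
Definition nheight (x : nat) : nat := \sum_(y < L) height x y.

Lemma sum_shift (k : nat) (f : nat -> bool) :
  f 0 = false -> f k = false -> \sum_(i < k) f i.+1 = \sum_(i < k) f i.
Proof.
move=> f0 fk; have : \sum_(i < k.+1) f i = \sum_(i < k.+1) f i by [].
by rewrite {1}big_ord_recl big_ord_recr /= f0 fk addn0.
Qed.

Lemma odd_ncr (x : nat) : odd (ncr x) = odd (nheight x) (+) odd (nheight x.+1).
Proof.
rewrite /ncr /nheight -oddD -big_split /=.
elim/big_rec2: _ => // i a b _; rewrite !oddD !oddb => ->.
by rewrite height_cr addKb.
Qed.

(** The count is [hheight] above the board, where [height] vanishes. *)
Lemma nhr_even (x : nat) : odd (nhr x) = false.
Proof. by rewrite -[odd _]/(hheight x L) -heightE height0 //; lia. Qed.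

(** The degrees in the column sum to [2 * n], and also to twice
    [ncr x + ncr x.+1 + nhr x + nhr x.+2]. Halve, and drop the even [nhr] terms. *)
Lemma odd_ncrS (x : nat) :
  1 <= x <= m -> odd (ncr x.+1) = odd (ncr x) (+) odd n.
Proof.
move=> xm; have : \sum_(y < L) degree x y = n.*2.
  rewrite 3!big_ord_recr big_ord_recl /=.
  rewrite (eq_bigr (fun=> 2)) => [|i _]; last by rewrite degree2 //= xm ltn_ord.
  rewrite sum_nat_const card_ord.
  have off y : ~~ (1 <= y <= n) -> degree x y = 0.
    by move=> yn; rewrite /degree !cr0 ?hr0 //; move: yn; lia.
  by rewrite !off //; lia.
have sh (f : nat -> bool) : f 0 = false -> f L = false -> f 1 = false ->
    f L.+1 = false -> \sum_(y < L) f y.+2 = \sum_(y < L) f y.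
  by move=> *; rewrite (sum_shift (f := fun y => f y.+1)) // sum_shift.
rewrite /degree !big_split /= !sh ?cr0 ?sum_shift ?hr0 //; try lia.
rewrite -/(ncr x) -/(ncr x.+1) -/(nhr x) -/(nhr x.+2).
by have := nhr_even x; have := nhr_even x.+2; lia.
Qed.

Lemma odd_ncrE (x : nat) : x <= m -> odd (ncr x.+1) = odd (x * n).
Proof.
elim: x => [|x IHx] xm.
  by rewrite /ncr big1 // => j _; rewrite cr0.
by rewrite odd_ncrS ?xm // IHx 1?ltnW // mulSn oddD addbC.
Qed.

(** There are no crosses past the last column, so [ncr m.+1] is 0. *)
Lemma even_area : ~~ odd (m * n).
Proof.
by rewrite -odd_ncrE // /ncr big1 // => j _; rewrite cr0 //; lia.
Qed.

Lemma even_height : ~~ odd (\sum_(x < m.+4) \sum_(y < n.+4) height x y).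
Proof.
rewrite -[X in odd X]/(\sum_(x < m.+4) nheight x).
have nh0 x : ~~ (3 <= x <= m) -> nheight x = 0.
  by move=> xm; rewrite /nheight big1 // => y _; rewrite height0 //; lia.
(* Columns [k.*2.+1] and [k.*2.+2] together have the parity of [ncr k.*2.+1], which is that of
   [k.*2 * n], or 0 past the board. *)
have evenS k : odd (\sum_(x < k.*2.+1) nheight x) = false.
  elim: k => [|k IHk]; first by rewrite big_ord_recl big_ord0 nh0.
  rewrite doubleS 2!big_ord_recr /= -addnA !oddD IHk addFb -odd_ncr.
  have [km|km] := leqP k.*2 m; first by rewrite odd_ncrE // oddM odd_double.
  by rewrite /ncr big1 // => j _; rewrite cr0 //; lia.
have := evenS m.+4; rewrite -(subnKC (_ : m.+4 <= m.+4.*2.+1)); last by lia.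
rewrite big_split_ord /= [X in _ + X]big1 ?addn0 => [->//|i _].
by rewrite nh0 //; lia.
Qed.

End Height.

(** * From the graph to the colouring *)

Definition nat_dist (a b : nat) : nat := (a - b) + (b - a).

Lemma normr_natB (a b : nat) : (`|a%:R - b%:R| = (nat_dist a b)%:R :> rat)%R.
Proof.
rewrite /nat_dist; have [le_ab|/ltnW le_ba] := leqP a b.
  by rewrite distrC -natrB // normr_nat; congr (_%:R)%R; lia.
by rewrite -natrB // normr_nat; congr (_%:R)%R; lia.
Qed.

Lemma knight_moveE (m n : nat) (s t : square m n) : knight_move s t =
  (nat_dist s.1 t.1 == 1) && (nat_dist s.2 t.2 == 2) ||
  (nat_dist s.1 t.1 == 2) && (nat_dist s.2 t.2 == 1).
Proof.
rewrite /knight_move /point /= !normr_natB.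
rewrite !pnatr_eq1 !eqr_nat.
by rewrite /nat_dist !subSS.
Qed.

Lemma midpointE (m n : nat) (s t u v : square m n) :
  midpoint u v = midpoint s t ->
  (u.1 + v.1 = s.1 + t.1 /\ u.2 + v.2 = s.2 + t.2)%N.
Proof.
have half (a b c d : nat) :
    ((a.+1%:R + b.+1%:R) / 2 = (c.+1%:R + d.+1%:R) / 2 :> rat)%R ->
    (a + b = c + d)%N.
  have two : (2%:R != 0 :> rat)%R by [].
  by move=> /(divIf two) /eqP; rewrite -!natrD eqr_nat; lia.
by case/pair_equal_spec => /half ? /half.
Qed.

(** Equal sums give distances of equal parity; both being 1 or 2, they are equal. *)
Lemma mid_swap (a b c d : nat) : a + b = c + d ->
    0 < nat_dist a b <= 2 -> 0 < nat_dist c d <= 2 ->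
  a = c /\ b = d \/ a = d /\ b = c.
Proof.
rewrite /nat_dist => sum; have [le_ab|/ltnW le_ba] := leqP a b;
  have [le_cd|/ltnW le_dc] := leqP c d => ab cd.
- by left; lia.
- by right; lia.
- by right; lia.
- by left; lia.
Qed.

Lemma val_ordD1 (k : nat) (a : 'I_k.+4) :
  a < k.+3 -> (a + 1)%R = a.+1 :> nat.
Proof. by move=> lt_ak; rewrite /= addn1 modn_small. Qed.

Lemma val_ordB1 (k : nat) (a : 'I_k.+4) : 0 < a -> (a - 1)%R = a.-1 :> nat.
Proof.
move=> a_gt0; have := val_ordD1 (a := (a - 1)%R); rewrite subrK => aE.
have := ltn_ord (a - 1)%R; rewrite ltnS leq_eqVlt => /orP[/eqP bE|/aE -> //].
have : a = 0%R.
  rewrite -[a](subrK 1%R); apply: val_inj; rewrite /= in bE *.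
  by rewrite bE addn1 modnn.
by move=> a0; rewrite a0 in a_gt0.
Qed.

HB.instance Definition _ (A B : finZmodType) := GRing.Zmodule.on (A * B)%type.

(** * Coordinates on the torus *)

Section Torus.

Variables (m n : nat).
Local Notation V := ('I_m.+4 * 'I_n.+4)%type.

Definition coord (v : V) : nat * nat := (v.1 : nat, v.2 : nat).

Lemma coord_inj : injective coord.
Proof. by move=> [a b] [c d] [] /val_inj -> /val_inj ->. Qed.

Definition east : V := (1, 0)%R.
Definition north : V := (0, 1)%R.

Lemma coord_king (v : V) (i : 'Z_8) :
    0 < v.1 < m.+3 -> 0 < v.2 < n.+3 ->
  let x : nat := v.1 in let y : nat := v.2 in
  coord (v + king east north i)%R =
  nth (0, 0) [:: (x.+1, y); (x.+1, y.+1); (x, y.+1); (x.-1, y.+1); (x.-1, y);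
                 (x.-1, y.-1); (x, y.-1); (x.+1, y.-1)] i.
Proof.
case: v => a b /= /andP[a0 am] /andP[b0 bn]; rewrite /king /coord.
case: i => [[|[|[|[|[|[|[|[|//]]]]]]]] lti];
  rewrite [nth _ _ _]/= [nth (0, 0) _ _]/=.
all: rewrite [X in (nat_of_ord X, _)]/= [X in (_, nat_of_ord X)]/=.
all: by rewrite ?addr0 ?add0r ?sub0r ?subr0 ?val_ordD1 ?val_ordB1.
Qed.

End Torus.

(** * The crosses of the graph and their colouring *)

Section Board.

Variables (m n : nat) (G : rel (square m n)).
Hypothesis hG : knight_pseudotour G.
Hypothesis hc : crosspatch G.

Let G_sym : symmetric G. Proof. by case: hG. Qed.

(* The offset 2 keeps the predecessors below from truncating at the edge of the
   board, and knight moves from the board from wrapping around the torus. *)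
Definition pos (s : square m n) : nat * nat := (s.1.+2, s.2.+2).

Lemma pos_inj : injective pos.
Proof. by move=> [i j] [k l] [] /val_inj -> /val_inj ->. Qed.

Definition edge (a b : nat * nat) : bool :=
  [exists s, exists t, [&& pos s == a, pos t == b & G s t]].

Lemma edgeP (a b : nat * nat) :
  reflect (exists s t, [/\ pos s = a, pos t = b & G s t]) (edge a b).
Proof.
apply: (iffP existsP) => [[s /existsP[t /and3P[/eqP ? /eqP ? ?]]]|[s [t [? ? ?]]]].
  by exists s, t.
by exists s; apply/existsP; exists t; apply/and3P; split=> //; apply/eqP.
Qed.

Lemma edge_pos (s t : square m n) : edge (pos s) (pos t) = G s t.
Proof.
by apply/edgeP/idP => [[s' [t' [/pos_inj -> /pos_inj ->]]]|Gst]; last exists s, t.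
Qed.

Lemma edge_sym : symmetric edge.
Proof.
by move=> a b; apply/edgeP/edgeP => -[s [t [sE tE Gst]]]; exists t, s; rewrite G_sym.
Qed.

Lemma edge_range (a b : nat * nat) : edge a b ->
  [&& 2 <= a.1 < m.+2, 2 <= a.2 < n.+2, 2 <= b.1 < m.+2 & 2 <= b.2 < n.+2].
Proof. by case/edgeP=> [s [t [<- <- _]]]; rewrite /= !ltnS !ltn_ord. Qed.

(** The partner in a cross is the other diagonal of the same rectangle: agreement or exchange in
    both coordinates would give the same edge. *)
Lemma crossP (s t : square m n) : G s t -> exists u v,
  [/\ G u v, u.1 = s.1, v.1 = t.1, u.2 = t.2 & v.2 = s.2].
Proof.
have G_knight u v : G u v -> knight_move u v by case: hG => _ /(_ u v).
move=> Gst; have [u [v [Guv uv /midpointE[mid1 mid2]]]] := hc Gst.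
have kn1 x y : G x y -> 0 < nat_dist x.1 y.1 <= 2.
  by move/G_knight; rewrite knight_moveE => /orP[] /andP[/eqP-> _].
have kn2 x y : G x y -> 0 < nat_dist x.2 y.2 <= 2.
  by move/G_knight; rewrite knight_moveE => /orP[] /andP[_ /eqP->].
have same (x y : square m n) : x.1 = y.1 :> nat -> x.2 = y.2 :> nat -> x = y.
  by case: x y => [? ?] [? ?] /= /val_inj -> /val_inj ->.
have := mid_swap mid2 (kn2 _ _ Guv) (kn2 _ _ Gst).
have := mid_swap mid1 (kn1 _ _ Guv) (kn1 _ _ Gst).
case=> [[u1 v1]|[u1 v1]] [[u2 v2]|[u2 v2]].
- by rewrite (same u s) // (same v t) // eqxx in uv.
- by exists u, v; split=> //; apply: val_inj.
- by exists v, u; split; rewrite 1?G_sym //; apply: val_inj.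
- by rewrite (same u t) // (same v s) // setUC eqxx in uv.
Qed.

Lemma cross_edge (x y x' y' : nat) :
  edge (x, y) (x', y') = edge (x, y') (x', y).
Proof.
have sub a b c d : edge (a, b) (c, d) -> edge (a, d) (c, b).
  case/edgeP => s [t [/pair_equal_spec[<- <-] /pair_equal_spec[<- <-] /crossP]].
  by case=> u [v [Guv u1 v1 u2 v2]]; rewrite -u1 -u2 -v1 -v2 edge_pos.
by apply/idP/idP; apply: sub.
Qed.

(** One diagonal suffices to detect a cross, by [cross_edge]. *)
Definition col_cross (x y : nat) : bool := edge (x, y.-1) (x.+1, y.+1).
Definition row_cross (x y : nat) : bool := edge (x.-1, y) (x.+1, y.+1).

Lemma col_cross_supp (x y : nat) :
  col_cross x y -> (2 <= x <= m) && (3 <= y <= n).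
Proof. by move=> /edge_range /=; lia. Qed.

Lemma row_cross_supp (x y : nat) :
  row_cross x y -> (3 <= x <= m) && (2 <= y <= n).
Proof. by move=> /edge_range /=; lia. Qed.

(** The entry at [i] is the point reached by king steps [i] and [i - 1] together. *)
Definition knight_target (s : square m n) (i : 'Z_8) : nat * nat :=
  let x := s.1.+2 in let y := s.2.+2 in
  nth (0, 0) [:: (x.+2, y.-1); (x.+2, y.+1); (x.+1, y.+2); (x.-1, y.+2);
                 (x.-2, y.+1); (x.-2, y.-1); (x.-1, y.-2); (x.+1, y.-2)] i.

Lemma edge_target (s : square m n) (i : 'Z_8) :
  let x := s.1.+1 in let y := s.2.+1 in
  edge (pos s) (knight_target s i) =
  nth false [:: row_cross x.+2 y; row_cross x.+2 y.+1;
                col_cross x.+1 y.+2; col_cross x y.+2;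
                row_cross x y.+1; row_cross x y;
                col_cross x y; col_cross x.+1 y] i.
Proof.
rewrite /knight_target /row_cross /col_cross /pos /=.
case: i => [[|[|[|[|[|[|[|[|//]]]]]]]] lti] /=.
- by rewrite cross_edge.
- by [].
- by [].
- by rewrite edge_sym cross_edge.
- by rewrite edge_sym cross_edge.
- by rewrite edge_sym.
- by rewrite edge_sym.
- by rewrite cross_edge.
Qed.

Lemma sum_target (s t : square m n) :
  knight_move s t -> \sum_(i : 'Z_8) (pos t == knight_target s i) = 1.
Proof.
rewrite knight_moveE /knight_target /pos !big_ord_recl big_ord0 /=.
rewrite !xpair_eqE !eqSS.
have dist_cases (a b k : nat) : nat_dist a b = k -> b = k + a \/ a = k + b.
  by rewrite /nat_dist; lia.
move: (s.1 : nat) (s.2 : nat) (t.1 : nat) (t.2 : nat) => a b c d.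
case/orP => /andP[/eqP/dist_cases[]-> /eqP/dist_cases[]->];
  rewrite ?add1n ?add2n ?eqSS ?eqxx.
all: lia.
Qed.

(** Double counting: each neighbour of [s] is the target of exactly one index. *)
Lemma sum_edge_target (s : square m n) :
  \sum_(i : 'Z_8) edge (pos s) (knight_target s i) = 2.
Proof.
case: hG => _ G_knight /(_ s) deg; rewrite -[RHS]deg -sum1_card.
rewrite [RHS](eq_bigr (fun t =>
  \sum_(i : 'Z_8) (pos t == knight_target s i : nat))).
  rewrite [RHS]exchange_big; apply: eq_bigr => i _.
  have [/edgeP[s' [t [/pos_inj -> tE Gst]]]|nedge] := boolP (edge _ _).
    rewrite (bigD1 t) ?inE // -tE eqxx big1 // => u /andP[_ nut].
    by rewrite (inj_eq pos_inj) (negbTE nut).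
  rewrite big1 // => t; rewrite inE => Gst; case: eqP => // tE.
  by rewrite -tE edge_pos Gst in nedge.
by move=> t; rewrite inE => /G_knight/sum_target.
Qed.

Lemma degree_cross (x y : nat) : (1 <= x <= m) && (1 <= y <= n) ->
  degree col_cross row_cross x y = 2.
Proof.
case: x y => [//|x] [|y]; first by rewrite andbF.
move=> /andP[xm yn]; have := sum_edge_target (Ordinal xm, Ordinal yn).
under eq_bigr do rewrite edge_target.
by rewrite !big_ord_recl big_ord0 /degree /= => <-; lia.
Qed.

Local Notation V := ('I_m.+4 * 'I_n.+4)%type.
Local Notation d := (king (east m n) (north m n)).
Local Notation h := (height col_cross).

Definition site (s : square m n) : V := (inord s.1.+2, inord s.2.+2).

Lemma coord_site (s : square m n) : coord (site s) = pos s.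
Proof.
have lt1 := ltn_ord s.1; have lt2 := ltn_ord s.2.
rewrite /coord /site /pos /= !inordK // !ltnS.
  exact: leqW (ltnW lt2).
exact: leqW (ltnW lt1).
Qed.

Lemma site_inj : injective site.
Proof. by move=> s t st; apply: pos_inj; rewrite -!coord_site st. Qed.

Definition inside : {pred V} := [pred v | h (coord v).1 (coord v).2].

Lemma insideE (v : V) : inside v = h (coord v).1 (coord v).2.
Proof. by []. Qed.

Lemma codom_site (v : V) :
  2 <= v.1 < m.+2 -> 2 <= v.2 < n.+2 -> v \in codom site.
Proof.
move=> /andP[v1 v1m] /andP[v2 v2n]; apply/codomP.
have lt1 : v.1.-2 < m by lia.
have lt2 : v.2.-2 < n by lia.
exists (Ordinal lt1, Ordinal lt2); apply: coord_inj; rewrite coord_site.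
by rewrite /coord /pos /=; congr (_, _); lia.
Qed.

(** The colouring is supported one step inside the board, so king steps from it neither leave the
    board nor wrap. *)
Lemma inside_codom (v : V) (i : 'Z_8) : inside v -> (v + d i)%R \in codom site.
Proof.
rewrite /inside /= => /(height_supp col_cross_supp row_cross_supp degree_cross).
have := @coord_king _ _ v i; rewrite /=.
move: (nat_of_ord v.1) (nat_of_ord v.2) => x y vE xy.
have /vE {}vE : 0 < x < m.+3 by lia.
have /vE {}vE : 0 < y < n.+3 by lia.
case: i vE => [[|[|[|[|[|[|[|[|//]]]]]]]] lti] /= /pair_equal_spec[v1 v2].
all: by apply: codom_site; rewrite ?v1 ?v2; lia.
Qed.

Lemma coord_ring (s : square m n) (i : 'Z_8) :
  let x := s.1.+2 in let y := s.2.+2 in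
  coord (site s + d i)%R =
  nth (0, 0) [:: (x.+1, y); (x.+1, y.+1); (x, y.+1); (x.-1, y.+1); (x.-1, y);
                 (x.-1, y.-1); (x, y.-1); (x.+1, y.-1)] i.
Proof.
have /pair_equal_spec[s1 s2] := coord_site s.
have := @coord_king _ _ (site s) i; rewrite /= s1 s2.
by apply; rewrite /= !ltnS ltnW // ltn_ord.
Qed.

(** Consecutive ring points are lattice neighbours whose midpoint is that of the knight move; they
    differ in colour iff a cross is centred there. *)
Lemma inside_change (s : square m n) (i : 'Z_8) :
  (inside (site s + d i)%R != inside (site s + d (i - 1))%R) =
  edge (pos s) (knight_target s i).
Proof.
rewrite !insideE !coord_ring edge_target.
have addbE (a b : bool) : (a (+) b != a) = b by case: a; case: b.
have col x y : (h x.+1 y != h x y) = col_cross x y by rewrite height_cr addbE.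
have row x y : (h x y.+1 != h x y) = row_cross x y.
  by rewrite (height_hr col_cross_supp row_cross_supp degree_cross) addbE.
case: i => [[|[|[|[|[|[|[|[|//]]]]]]]] lti] /=; rewrite ?row ?col //.
all: by rewrite eq_sym ?row ?col.
Qed.

Lemma coord_step (s : square m n) (i : 'Z_8) :
  coord (site s + d i + d (i - 1))%R = knight_target s i.
Proof.
have := coord_ring s i; move: (site s + d i)%R => w.
have := @coord_king _ _ w (i - 1)%R; move: (coord (w + _)%R) => c.
have := ltn_ord s.1; have := ltn_ord s.2; rewrite /coord /knight_target /=.
move: (nat_of_ord s.1) (nat_of_ord s.2) (nat_of_ord w.1) (nat_of_ord w.2).
move=> a b x y lt2 lt1.
case: i => [[|[|[|[|[|[|[|[|//]]]]]]]] lti] /= cE /pair_equal_spec[xE yE].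
all: by rewrite xE yE in cE; rewrite cE //; lia.
Qed.

Lemma G_stepE (s t : square m n) : G s t =
  [exists i, (inside (site s + d i)%R != inside (site s + d (i - 1))%R) &&
             (site t == site s + d i + d (i - 1))%R].
Proof.
have stepE i :
    (site t == site s + d i + d (i - 1))%R = (pos t == knight_target s i).
  by rewrite -(inj_eq (@coord_inj _ _)) coord_site coord_step.
apply/idP/existsP => [Gst|[i]]; last first.
  by rewrite inside_change stepE => /andP[+ /eqP tE]; rewrite -tE edge_pos.
have /sum_target : knight_move s t by case: hG => _ + _; apply.
have [i tE _|none] := pickP (fun i => pos t == knight_target s i).
  by exists i; rewrite inside_change stepE tE -(eqP tE) edge_pos Gst.
by rewrite big1 // => i _; rewrite none.
Qed.

(** Pointwise, [(b != b') + b = 2 * (b && ~~ b') + b']. Summed around the ring, [b] and [b'] cancel,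
    so the two changes make one rise. *)
Lemma card_rise (s : square m n) :
  #|[pred i | inside (site s + d i)%R && ~~ inside (site s + d (i - 1))%R]| = 1.
Proof.
have := sum_edge_target s; pose b i := inside (site s + d i)%R.
under eq_bigr do rewrite -inside_change -!/(b _).
have sum_b : \sum_(i : 'Z_8) b (i - 1)%R = \sum_(i : 'Z_8) b i.
  by rewrite [RHS](reindex_inj (addIr (-1 : 'Z_8)%R)).
have sum_rise : \sum_(i : 'Z_8) (b i != b (i - 1)%R) + \sum_(i : 'Z_8) b i =
    (\sum_(i : 'Z_8) (b i && ~~ b (i - 1)%R)).*2 + \sum_(i : 'Z_8) b (i - 1)%R.
  rewrite -mul2n big_distrr -!big_split; apply: eq_bigr => i _ /=.
  by case: (b i); case: (b _).
move: sum_rise; rewrite sum_b => /addIn -> /(congr1 half); rewrite doubleK => sumE.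
rewrite -[RHS]/(2./2) -sumE.
rewrite -sum1_card big_mkcond; apply: eq_bigr => i _.
by rewrite inE -!/(b _); case: (_ && _).
Qed.

Lemma even_num_components : ~~ odd (num_components G).
Proof.
rewrite /num_components.
rewrite (@odd_n_comp _ (east m n) (north m n) inside _ G site).
- have -> : #|inside| = \sum_(x < m.+4) \sum_(y < n.+4) h x y.
    by rewrite pair_bigA -sum1_card big_mkcond.
  rewrite card_prod !card_ord.
  rewrite (negbTE (even_height col_cross_supp row_cross_supp degree_cross)).
  by rewrite addbF (even_area col_cross_supp row_cross_supp degree_cross).
- exact: site_inj.
(* Stepping back by [i + 4] from a coloured point returns to [v], which is therefore on the
   board. *)
- move=> v i; apply: contra => /(inside_codom (i + 4%:R)%R).
  by rewrite king_opp addrK.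
- exact: G_sym.
- exact: G_stepE.
- move=> s; have [i rise_i] := mem_card1 (card_rise s); exists i.
  by have := rise_i i; rewrite !inE eqxx.
move=> s i j ri rj; have [k rise_k] := mem_card1 (card_rise s).
have := rise_k i; have := rise_k j; rewrite /rise in ri rj.
by rewrite !inE ri rj => /esym/eqP -> /esym/eqP.
Qed.

End Board.

Theorem theorem1 (m n : nat) (hm : (1 <= m)%N) (hn : (1 <= n)%N)
    (G : rel (square m n)) (hG : knight_pseudotour G) (hc : crosspatch G) :
  ~~ odd (num_components G).
Proof. exact: even_num_components hG hc. Qed.
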